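(* Let $n\ge 5$ and let $D$ be an $n\times n$ Euclidean distance matrix with embedding dimension $r=3$, with generating points $p^1,\ldots,p^n\in\mathbb{R}^r$ affinely spanning $\mathbb{R}^r$ and satisfying $\sum_{i=1}^n p^i=\mathbf{0}$. Let $P$ be the $n\times r$ matrix whose $i$-th row is $(p^i)^T$, let $B=PP^T$, let $b=\mathrm{diag}(B)\in\mathbb{R}^n$, let $B^{\dagger}$ be the Moore-Penrose inverse of $B$, and let $Z$ be a Gale matrix of $D$. Then a vector $d^m\in\mathbb{R}^n$ is self-consistent if and only if $$Z^T(d^m-b)=\mathbf{0}\quad\text{and}\quad (d^m-b)^TB^{\dagger}(d^m-b)-\frac{4}{n}e^T(d^m-b)=0.$$
   Context: An $n\times n$ matrix $D=(d_{ij})$ is a Euclidean distance matrix (EDM) if there are points $p^1,\ldots,p^n$ (generating points of $D$) in some Euclidean space with $d_{ij}=\|p^i-p^j\|^2$ for all $i,j$; the dimension of their affine span is the embedding dimension of $D$. For an $n\times n$ EDM $D$ with embedding dimension $r$, a vector $y\in\mathbb{R}^n$ is called self-consistent if the $(n+1)\times(n+1)$ matrix $\begin{bmatrix}0&y^T\\ y&D\end{bmatrix}$ is an EDM with embedding dimension $r$. Here $e$ is the all-ones vector and $\mathrm{diag}(B)$ is the vector of diagonal entries of $B$. A Gale matrix of $D$ is any $n\times(n-r-1)$ matrix $Z$ whose columns form a basis of the null space of $\begin{bmatrix}P^T\\ e^T\end{bmatrix}$. *)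

(* Defs.v *)
From HB Require Import structures.
From mathcomp Require Import all_boot all_order all_algebra.
From mathcomp Require Import reals.
Set Implicit Arguments.
Unset Strict Implicit.
Unset Printing Implicit Defensive.
Import Order.TTheory GRing.Theory Num.Theory.
Local Open Scope ring_scope.

(* Vectors of R^n are column vectors 'cV_n; a configuration p^1, ..., p^n of
   points of R^k is the matrix P : 'M_(n, k) whose i-th row is (p^i)^T. *)

Section Definitions.
Variable R : realType.

(* Squared Euclidean norm.  The norm `|u| that MathComp-Analysis puts on
   matrices is the sup norm, hence the explicit sum of squares. *)
Definition sqnorm k (u : 'rV[R]_k) : R := \sum_(i < k) u 0 i ^+ 2.

Definition ones n : 'cV[R]_n := const_mx 1.

Definition diagv n (B : 'M[R]_n) : 'cV[R]_n := \col_i B i i.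

Definition generates n k (P : 'M[R]_(n, k)) (D : 'M[R]_n) : Prop :=
  forall i j : 'I_n, D i j = sqnorm (row i P - row j P).

(* The row space of this matrix is the linear span of the differences
   p^i - p^j, i.e. the direction of the affine span of the points. *)
Definition affine_direction n k (P : 'M[R]_(n, k)) : 'M[R]_k :=
  (\sum_(i < n) \sum_(j < n) <<row i P - row j P>>)%MS.

Definition affine_dim n k (P : 'M[R]_(n, k)) : nat :=
  \rank (affine_direction P).

Definition affinely_spans n k (P : 'M[R]_(n, k)) : Prop :=
  forall x : 'rV[R]_k, exists w : 'I_n -> R,
    \sum_(i < n) w i = 1 /\ x = \sum_(i < n) w i *: row i P.

Definition EDM_embdim n (D : 'M[R]_n) (r : nat) : Prop :=
  exists k (P : 'M[R]_(n, k)), generates P D /\ affine_dim P = r.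

Definition bordered n (y : 'cV[R]_n) (D : 'M[R]_n) : 'M[R]_(1 + n) :=
  block_mx 0 y^T y D.

(* Meant for an EDM D of embedding dimension r. *)
Definition self_consistent n (D : 'M[R]_n) (r : nat) (y : 'cV[R]_n) : Prop :=
  EDM_embdim (bordered y D) r.

(* kermx is the left kernel, a space of row vectors, so the null space
   {x | [P^T; e^T] x = 0} is, up to transposition, the row space of
   kermx [P^T; e^T]^T. *)
Definition gale_matrix n r (P : 'M[R]_(n, r)) (Z : 'M[R]_(n, n - r - 1)) :=
  row_free Z^T /\ (Z^T :=: kermx (col_mx P^T (ones n)^T)^T)%MS.

Definition moore_penrose m n (A : 'M[R]_(m, n)) (X : 'M[R]_(n, m)) : Prop :=
  [/\ A *m X *m A = A, X *m A *m X = X,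
      (A *m X)^T = A *m X & (X *m A)^T = X *m A].

Lemma moore_penrose_uniq m n (A : 'M[R]_(m, n)) X Y :
  moore_penrose A X -> moore_penrose A Y -> X = Y.
Proof.
move=> [x1 x2 x3 x4] [y1 y2 y3 y4].
have eAX : A *m X = A *m Y.
  rewrite -[in LHS]y1 -!mulmxA [A *m (Y *m _)]mulmxA -x3 -y3 -trmx_mul.
  by rewrite mulmxA x1.
have eXA : X *m A = Y *m A.
  rewrite -[in LHS]y1 -!mulmxA [X *m (A *m _)]mulmxA -x4 -y4 -trmx_mul.
  by rewrite -!mulmxA [A *m (X *m A)]mulmxA x1.
by rewrite -x2 -mulmxA eAX mulmxA eXA y2.
Qed.

Lemma gram_unitmx m n (F : 'M[R]_(m, n)) : row_free F -> F *m F^T \in unitmx.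
Proof.
move=> Ffree; rewrite -row_free_unit; apply: inj_row_free => v vG0.
apply: (row_free_inj Ffree); rewrite mul0mx.
have /matrixP/(_ 0 0) : (v *m F) *m (v *m F)^T = 0.
  by rewrite trmx_mul mulmxA -(mulmxA v) vG0 mul0mx.
rewrite !mxE => /eqP; rewrite psumr_eq0 => [/allP s0|i _]; last first.
  by rewrite [_^T _ _]mxE -expr2 sqr_ge0.
apply/rowP => i; have := s0 i (mem_index_enum _).
by rewrite /= [_^T _ _]mxE -expr2 sqrf_eq0 [in RHS]mxE => /eqP.
Qed.

Lemma moore_penrose_exists m n (A : 'M[R]_(m, n)) :
  exists X, moore_penrose A X.
Proof.
have [r [C [F [-> fC fF]]]] : exists r (C : 'M_(m, r)) (F : 'M_(r, n)),
    [/\ A = C *m F, row_full C & row_free F].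
  exists (\rank A), (col_base A), (row_base A).
  by rewrite mulmx_base col_base_full row_base_free.
have uF : F *m F^T \in unitmx by exact: gram_unitmx.
have uC : C^T *m C \in unitmx.
  by rewrite -{2}[C]trmxK; apply: gram_unitmx; rewrite /row_free mxrank_tr.
pose X := F^T *m invmx (F *m F^T) *m invmx (C^T *m C) *m C^T.
have AX : C *m F *m X = C *m invmx (C^T *m C) *m C^T.
  by rewrite /X !mulmxA -(mulmxA C F) mulmxK.
have XA : X *m (C *m F) = F^T *m invmx (F *m F^T) *m F.
  by rewrite /X !mulmxA -(mulmxA _ C^T C) mulmxKV.
exists X; split.
- by rewrite AX !mulmxA -(mulmxA _ C^T C) mulmxKV.
- by rewrite XA /X !mulmxA -(mulmxA _ F F^T) mulmxKV.
- by rewrite AX !trmx_mul trmx_inv trmx_mul trmxK mulmxA.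
- by rewrite XA !trmx_mul trmx_inv trmx_mul trmxK mulmxA.
Qed.

End Definitions.

(* Main.v *)
Require Import Defs.
From HB Require Import structures.
From mathcomp Require Import all_boot all_order all_algebra.
From mathcomp Require Import reals.
From mathcomp Require Import ring.
Set Implicit Arguments.
Unset Strict Implicit.
Unset Printing Implicit Defensive.
Import Order.TTheory GRing.Theory Num.Theory.
Local Open Scope ring_scope.

(** [dm] is self-consistent iff it is the vector of squared distances from some
    point x of R^3 to the p^i.  Indeed the generating points of a bordered EDM
    of the same embedding dimension lie in the affine span of the last n of
    them, so the affine coordinates of the new point can be transported to the
    p^i.  Now |x - p^i|^2 = b_i - 2 <p^i, x> + |x|^2, i.e.
    dm - b = P u + c e with u = - 2 x and c = |x|^2 = |u|^2 / 4.  The Gale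
    condition says that dm - b has the form P u + c e, and then the quadratic
    condition reads |u|^2 - 4 c = 0, because P^T B^+ P = 1, B^+ e = 0 and
    e^T P = 0. *)

Section SelfConsistency.
Variable R : realType.

(** Moving the [i0]-th point to the origin makes affine questions linear. The zero row [i0] is kept
    so that rows remain indexed by the points. *)
Definition edges n k (A : 'M[R]_(n, k)) (i0 : 'I_n) : 'M[R]_(n, k) :=
  \matrix_i (row i A - row i0 A).

Lemma sqnormE k (u : 'rV[R]_k) : sqnorm u = (u *m u^T) 0 0.
Proof. by rewrite /sqnorm mxE; apply: eq_bigr => i _; rewrite mxE expr2. Qed.

Lemma sqnormN k (u : 'rV[R]_k) : sqnorm (- u) = sqnorm u.
Proof. by rewrite !sqnormE linearN /= mulmxN mulNmx opprK. Qed.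

Lemma sqnormZ k a (u : 'rV[R]_k) : sqnorm (a *: u) = a ^+ 2 * sqnorm u.
Proof. by rewrite /sqnorm mulr_sumr; apply: eq_bigr => i _; rewrite mxE exprMn. Qed.

Lemma sqnormB k (u v : 'rV[R]_k) :
  sqnorm (u - v) = sqnorm u + sqnorm v - 2 * (u *m v^T) 0 0.
Proof.
rewrite mxE mulr_sumr /sqnorm -big_split -sumrB /=.
by apply: eq_bigr => i _; rewrite !mxE; ring.
Qed.

Lemma sqnormB_sym k (u v : 'rV[R]_k) : sqnorm (u - v) = sqnorm (v - u).
Proof. by rewrite -sqnormN opprB. Qed.

(** The law of cosines. Its right side involves only [D], so realizations of [D] in spaces of
    different dimensions share the same Gram matrix of edges. *)
Lemma edges_gramE n k (A : 'M[R]_(n, k)) (D : 'M[R]_n) (i0 i j : 'I_n) :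
  generates A D ->
  (edges A i0 *m (edges A i0)^T) i j = (D i i0 + D j i0 - D i j) / 2.
Proof.
move=> AD; have -> : D i j = sqnorm (row i (edges A i0) - row j (edges A i0)).
  by rewrite AD !rowK opprB addrA subrK.
have rE l : D l i0 = sqnorm (row l (edges A i0)) by rewrite AD rowK.
rewrite !rE sqnormB.
have -> : (edges A i0 *m (edges A i0)^T) i j =
          (row i (edges A i0) *m (row j (edges A i0))^T) 0 0.
  by rewrite !mxE; apply: eq_bigr => l _; rewrite !mxE.
by field.
Qed.

Lemma edges_gram_eq n k l (A : 'M[R]_(n, k)) (A' : 'M[R]_(n, l))
    (D : 'M[R]_n) (i0 : 'I_n) : generates A D -> generates A' D ->
  edges A i0 *m (edges A i0)^T = edges A' i0 *m (edges A' i0)^T.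
Proof. by move=> AD A'D; apply/matrixP => i j; rewrite !(@edges_gramE _ _ _ D). Qed.

Lemma sub_affine_direction n k (A : 'M[R]_(n, k)) (i j : 'I_n) :
  (row i A - row j A <= affine_direction A)%MS.
Proof.
by apply: (sumsmx_sup i) => //; apply: (sumsmx_sup j) => //; rewrite genmxE.
Qed.

Lemma mxrank_gram m k (A : 'M[R]_(m, k)) : row_full A ->
  \rank (A *m A^T) = k.
Proof.
move=> fA; have uA : A^T *m A \in unitmx.
  by rewrite -{2}[A]trmxK; apply: gram_unitmx; rewrite /row_free mxrank_tr.
have rA : \rank A = k by apply/eqP.
apply: anti_leq; apply/andP; split.
  by apply: leq_trans (mxrankM_maxl _ _) _; rewrite rA.
(* Since [A^T *m A] is invertible, this product has the rank of [A^T], which is [k]. *)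
apply: leq_trans (_ : \rank (A^T *m A *m A^T) <= _)%N.
  by rewrite eqmxMfull ?row_full_unit // mxrank_tr rA.
by rewrite -mulmxA mxrankM_maxr.
Qed.

Lemma affinely_spans_full n k (P : 'M[R]_(n, k)) : affinely_spans P -> row_full P.
Proof.
move=> sP; rewrite -sub1mx; apply/row_subP => i.
have [w [_ ->]] := sP (row i 1%:M).
by apply: summx_sub => j _; rewrite scalemx_sub ?row_sub.
Qed.

Lemma edges_full n k (P : 'M[R]_(n, k)) (i0 : 'I_n) :
  affinely_spans P -> row_full (edges P i0).
Proof.
move=> sP; rewrite -sub1mx; apply/row_subP => i.
(* The shift by [row i0 P] is undone using weights of sum 1, which leaves a linear combination of
   edges. *)
have [w [w1 e]] := sP (row i 1%:M + row i0 P).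
have -> : row i 1%:M = \sum_j w j *: row j (edges P i0).
  rewrite -[LHS](addrK (row i0 P)) e -[row i0 P]scale1r -w1 scaler_suml.
  by rewrite -sumrB; apply: eq_bigr => j _; rewrite rowK scalerBr.
by apply: summx_sub => j _; rewrite scalemx_sub ?row_sub.
Qed.

(** The coefficients [w - delta_mx 0 i] do not depend on [A], so by [sqnorm_mulmx] the distance from
    a point with edge coordinates [w] to the [i]-th point depends only on the Gram matrix of the
    edges. *)
Lemma edges_sub_delta n k (A : 'M[R]_(n, k)) (i0 i : 'I_n) (w : 'rV[R]_n) :
  w *m edges A i0 + row i0 A - row i A = (w - delta_mx 0 i) *m edges A i0.
Proof. by rewrite mulmxBl -rowE rowK opprB addrA. Qed.

Lemma sqnorm_mulmx n k (w : 'rV[R]_n) (A : 'M[R]_(n, k)) :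
  sqnorm (w *m A) = (w *m (A *m A^T) *m w^T) 0 0.
Proof. by rewrite sqnormE trmx_mul !mulmxA. Qed.

Lemma generates_bordered n k (D : 'M[R]_n) (P : 'M[R]_(n, k)) (x : 'rV[R]_k)
    (y : 'cV[R]_n) : generates P D ->
  (forall i, y i 0 = sqnorm (x - row i P)) ->
  generates (col_mx x P) (bordered y D).
Proof.
move=> PD yE i j; rewrite /bordered -[i]splitK -[j]splitK.
have r0 l : row l x = x by rewrite ord1; apply/rowP => c; rewrite mxE.
case: (split i) => i'; case: (split j) => j' /=;
  rewrite ?block_mxEul ?block_mxEur ?block_mxEdl ?block_mxEdr ?rowKu ?rowKd ?r0.
- by rewrite subrr mxE sqnormE mul0mx mxE.
- by rewrite mxE ord1 yE.
- by rewrite ord1 yE sqnormB_sym.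
- exact: PD.
Qed.

Lemma bordered_generates n k (D : 'M[R]_n) (Q : 'M[R]_(1 + n, k))
    (y : 'cV[R]_n) : generates Q (bordered y D) ->
  generates (dsubmx Q) D /\
  forall i, y i 0 = sqnorm (usubmx Q - row i (dsubmx Q)).
Proof.
have r0 : row (lshift n 0) Q = usubmx Q.
  by apply/rowP => c; rewrite !mxE.
have rd i : row (rshift 1 i) Q = row i (dsubmx Q).
  by apply/rowP => c; rewrite !mxE.
move=> QD; split=> [i j|i].
  by have := QD (rshift 1 i) (rshift 1 j); rewrite /bordered block_mxEdr !rd.
by have := QD (lshift n 0) (rshift 1 i); rewrite /bordered block_mxEur r0 rd mxE.
Qed.

Lemma self_consistentP n r (D : 'M[R]_n) (P : 'M[R]_(n, r)) (y : 'cV[R]_n) :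
  (0 < n)%N -> generates P D -> affinely_spans P ->
  self_consistent D r y <->
  exists x : 'rV[R]_r, forall i, y i 0 = sqnorm (x - row i P).
Proof.
move=> n0 PD sP; pose i0 := Ordinal n0; have fU := edges_full i0 sP.
split=> [[k [Q [QD dQ]]]|[x yE]]; last first.
  exists r, (col_mx x P); split; first exact: generates_bordered.
  (* In R^r, affine dimension [r] means that the direction is the whole space, and the edges of [P]
     already span it. *)
  apply/eqP; rewrite -[_ == _]/(row_full _) -sub1mx.
  apply: submx_trans (_ : (edges P i0 <= _)%MS); first by rewrite sub1mx.
  apply/row_subP => i; rewrite rowK.
  have := sub_affine_direction (col_mx x P) (rshift 1 i) (rshift 1 i0).
  by rewrite !rowKd.
have [dQD yE] := bordered_generates QD.
set T := edges (dsubmx Q) i0; set U := edges P i0.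
have TU : T *m T^T = U *m U^T by exact: edges_gram_eq dQD PD.
have sT : (T <= affine_direction Q)%MS.
  apply/row_subP => i; rewrite rowK.
  have := sub_affine_direction Q (rshift 1 i) (rshift 1 i0).
  by congr (_ - _ <= _)%MS; apply/rowP => c; rewrite !mxE.
(* Dimension count: the direction of [Q] has rank [r], and r = rank(U U^T) = rank(T T^T) <= rank T.
   Hence the extra point adds no dimension. *)
have eT : (affine_direction Q <= T)%MS.
  rewrite -(mxrank_leqif_sup sT) eqn_leq mxrankS //= -/(affine_dim Q) dQ.
  by rewrite -(mxrank_gram fU) -/U -TU mxrankM_maxl.
have /submxP[w wE] : (usubmx Q - row i0 (dsubmx Q) <= T)%MS.
  apply: submx_trans eT.
  have := sub_affine_direction Q (lshift n 0) (rshift 1 i0).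
  by congr (_ - _ <= _)%MS; apply/rowP => c; rewrite !mxE.
(* The point with the same edge coordinates [w], now relative to [P]; distances agree because [TU]
   equates the Gram matrices. *)
exists (w *m U + row i0 P) => i.
rewrite yE edges_sub_delta sqnorm_mulmx -TU -sqnorm_mulmx -edges_sub_delta.
by rewrite -wE subrK.
Qed.

Lemma kermx_mul0P (F : fieldType) m n (M : 'M[F]_(n, m)) (y : 'cV[F]_n) :
  kermx M *m y = 0 <-> exists u : 'cV[F]_m, y = M *m u.
Proof.
split=> [k0|[u ->]]; last by rewrite mulmxA mulmx_ker mul0mx.
suff /submxP[u yE] : (y^T <= M^T)%MS.
  by exists u^T; rewrite -[LHS]trmxK yE trmx_mul trmxK.
(* The cokernel of [M^T] tests membership in its row space; transposed, it consists of left-kernel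
   vectors of [M], which annihilate [y]. *)
have /submxP[W WE] : ((cokermx M^T)^T <= kermx M)%MS.
  by apply/sub_kermxP/trmx_inj; rewrite trmx_mul trmxK mulmx_coker trmx0.
rewrite submxE; apply/eqP/trmx_inj.
by rewrite trmx_mul trmxK WE -mulmxA k0 mulmx0 trmx0.
Qed.

(** The columns of [Z] span the orthogonal complement of the column space of [P e]. *)
Lemma gale_matrixP n r (P : 'M[R]_(n, r)) (Z : 'M[R]_(n, n - r - 1))
    (y : 'cV[R]_n) : gale_matrix P Z ->
  Z^T *m y = 0 <-> exists (u : 'cV[R]_r) (c : R), y = P *m u + c *: ones R n.
Proof.
move=> [_ ZE]; set M := (col_mx _ _)^T in ZE.
have ZK : Z^T *m y = 0 <-> kermx M *m y = 0.
  have [/submxP[V VE] /submxP[W WE]] : (Z^T <= kermx M)%MS /\ (kermx M <= Z^T)%MS.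
    by rewrite !ZE submx_refl.
  by split=> e; [rewrite WE | rewrite VE]; rewrite -mulmxA e mulmx0.
rewrite ZK kermx_mul0P /M tr_col_mx !trmxK; split=> [[u ->]|[u [c ->]]].
  exists (usubmx u), (dsubmx u 0 0).
  by rewrite -{1}[u]vsubmxK mul_row_col [dsubmx u]mx11_scalar mul_mx_scalar !mxE.
by exists (col_mx u c%:M); rewrite mul_row_col mul_mx_scalar.
Qed.

(** In P P^T X P P^T = P P^T, the outer factors [P] and [P^T] cancel because [P] has full column
    rank. *)
Lemma quad_moore_penrose n r (P : 'M[R]_(n, r)) (X : 'M[R]_n) :
  row_full P -> moore_penrose (P *m P^T) X -> P^T *m X *m P = 1%:M.
Proof.
move=> fP [X1 _ _ _].
apply: (row_free_inj (_ : row_free P^T)); first by rewrite /row_free mxrank_tr.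
by apply: (row_full_inj fP); rewrite mul1mx !mulmxA in X1 *.
Qed.

(** X = X (A X)^T = X X^T A^T. *)
Lemma moore_penrose_mul0 m n p (A : 'M[R]_(m, n)) X (v : 'M[R]_(m, p)) :
  moore_penrose A X -> A^T *m v = 0 -> X *m v = 0.
Proof.
move=> [_ X2 X3 _] v0.
by rewrite -X2 -mulmxA -mulmxA (mulmxA A) -X3 trmx_mul -!mulmxA v0 !mulmx0.
Qed.

(** X = (X A)^T X = A^T X^T X. *)
Lemma mul_moore_penrose0 m n p (A : 'M[R]_(m, n)) X (v : 'M[R]_(p, n)) :
  moore_penrose A X -> v *m A^T = 0 -> v *m X = 0.
Proof.
by move=> [_ X2 _ X4] v0; rewrite -X2 -X4 trmx_mul !mulmxA v0 !mul0mx.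
Qed.

End SelfConsistency.

Theorem mainTheorem2 (R : realType) (n : nat) (hn : (5 <= n)%N)
  (D : 'M[R]_n) (hD : EDM_embdim D 3)
  (P : 'M[R]_(n, 3)) (hgen : generates P D) (hspan : affinely_spans P)
  (hcentered : \sum_(i < n) row i P = 0)
  (B : 'M[R]_n) (hB : B = P *m P^T)
  (b : 'cV[R]_n) (hb : b = diagv B)
  (Bdag : 'M[R]_n) (hBdag : moore_penrose B Bdag)
  (Z : 'M[R]_(n, n - 3 - 1)) (hZ : gale_matrix P Z)
  (dm : 'cV[R]_n) :
  self_consistent D 3 dm <->
  Z^T *m (dm - b) = 0 /\
  (dm - b)^T *m Bdag *m (dm - b)
    - (4 / n%:R) *: ((ones R n)^T *m (dm - b)) = 0.
Proof.
have fP := affinely_spans_full hspan.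
have n0 : (0 < n)%N by apply: leq_trans hn.
have nR : n%:R != 0 :> R by rewrite pnatr_eq0 -lt0n.
have eP : (ones R n)^T *m P = 0.
  rewrite -hcentered; apply/rowP => j; rewrite mxE summxE.
  by apply: eq_bigr => i _; rewrite !mxE mul1r.
have Pe : P^T *m ones R n = 0 by apply: trmx_inj; rewrite trmx_mul trmxK eP trmx0.
have Bt : B^T = B by rewrite hB trmx_mul trmxK.
have Xe : Bdag *m ones R n = 0.
  by apply: moore_penrose_mul0 hBdag _; rewrite Bt hB -mulmxA Pe mulmx0.
have eX : (ones R n)^T *m Bdag = 0.
  by apply: mul_moore_penrose0 hBdag _; rewrite Bt hB mulmxA eP mul0mx.
have PXP : P^T *m Bdag *m P = 1%:M by apply: quad_moore_penrose; rewrite -?hB.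
have ee : (ones R n)^T *m ones R n = n%:R%:M.
  apply/matrixP => i j; rewrite !ord1 !mxE eqxx mulr1n.
  rewrite (eq_bigr (fun _ => 1)) => [|l _]; last by rewrite !mxE mulr1.
  by rewrite sumr_const card_ord.
(* Every term of the quadratic form containing [ones R n] vanishes, and e^T y = n c, so the factor
   4/n yields 4c. *)
have quadE (u : 'cV[R]_3) (c : R) (y : 'cV[R]_n) : y = P *m u + c *: ones R n ->
    y^T *m Bdag *m y - (4 / n%:R) *: ((ones R n)^T *m y)
      = (sqnorm u^T - 4 * c)%:M.
  move=> ->; rewrite [(_ + _)^T]linearD /= [(c *: _)^T]linearZ /= trmx_mul.
  rewrite !mulmxDl !mulmxDr.
  rewrite -!scalemxAl eX !mul0mx !scaler0 !addr0 -!scalemxAr.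
  rewrite -(mulmxA _ Bdag (ones R n)) Xe mulmx0 scaler0 addr0.
  rewrite !mulmxA eP mul0mx add0r ee -(mulmxA u^T) -(mulmxA u^T) PXP mulmx1.
  apply/matrixP => i j; rewrite !ord1 sqnormE trmxK !mxE eqxx !mulr1n.
  by congr (_ - _); field.
have distE (x : 'rV[R]_3) i : sqnorm (x - row i P) =
    (P *m (- 2 *: x^T) + sqnorm x *: ones R n) i 0 + b i 0.
  have -> : b i 0 = sqnorm (row i P).
    by rewrite hb hB !mxE; apply: eq_bigr => j _; rewrite !mxE expr2.
  have -> : (P *m (- 2 *: x^T) + sqnorm x *: ones R n) i 0 =
            - 2 * (x *m (row i P)^T) 0 0 + sqnorm x.
    rewrite !mxE mulr1 mulr_sumr; congr (_ + _).
    by apply: eq_bigr => j _; rewrite !mxE; ring.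
  by rewrite sqnormB; ring.
rewrite (self_consistentP _ n0 hgen hspan) (gale_matrixP _ hZ).
split=> [[x xE]|[[u [c uE]]]].
  have uE : dm - b = P *m (- 2 *: x^T) + sqnorm x *: ones R n.
    apply/colP => i.
    have -> : (dm - b) i 0 = dm i 0 - b i 0 by rewrite !mxE.
    by rewrite xE distE addrK.
  split; first by exists (- 2 *: x^T), (sqnorm x).
  rewrite (quadE _ _ _ uE) linearZ /= trmxK sqnormZ.
  by rewrite (_ : _ - _ = 0) ?raddf0 //; ring.
rewrite (quadE _ _ _ uE) => /matrixP/(_ 0 0); rewrite [LHS]mxE [RHS]mxE mulr1n.
move=> /subr0_eq cE.
(* This inverts u = -2x; by [cE] the resulting point has squared norm |u|^2 / 4 = c. *)
exists (- 2^-1 *: u^T) => i; rewrite distE [(_ *: _)^T]linearZ /= trmxK scalerA sqnormZ cE.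
have -> : - 2 * - 2^-1 = 1 :> R by field.
have -> : (- 2^-1) ^+ 2 * (4 * c) = c by field.
by rewrite scale1r -uE !mxE subrK.
Qed.
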